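(* For each integer $g\ge 0$ let $S_g$ be the set of numerical semigroups of genus $g$, let $n_g=\#S_g$, and let $S_g^{\bar\infty}=\{S\in S_g:\gcd(L(S))=1\}$, where $L(S)$ is the set of left elements of $S$. Then $$\lim_{g\to\infty}\frac{\#S_g^{\bar\infty}}{n_g}=1.$$
   Context: A numerical semigroup is a submonoid $S$ of the nonnegative integers $\mathbb{N}_0$ (under addition) whose complement $\mathbb{N}_0\setminus S$ is finite. The elements of $\mathbb{N}_0\setminus S$ are the gaps of $S$, and their number is the genus of $S$. The Frobenius number $F(S)$ is the largest gap of $S$. The left elements of $S$ are the elements of $S$ that are smaller than $F(S)$; $L(S)$ denotes the set of left elements. Since $0\in L(S)$ whenever $S$ has a gap, $\gcd(L(S))$ is the gcd of the nonzero left elements. *)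

(* Defs.v *)
From mathcomp Require Import all_boot all_order all_algebra finmap.
From mathcomp Require Import boolp classical_sets functions cardinality.

Set Implicit Arguments.
Unset Strict Implicit.
Unset Printing Implicit Defensive.

Local Open Scope classical_set_scope.
Local Open Scope nat_scope.

Definition numerical_semigroup (S : set nat) : Prop :=
  [/\ S 0, forall x y, S x -> S y -> S (x + y) & finite_set (~` S)].

Definition gaps (S : set nat) : set nat := ~` S.

Definition genus (S : set nat) : nat := #|` fset_set (gaps S)|.

(* When there is no gap, i.e. S is the set of all naturals, this is 0 rather
   than the conventional -1; S has no left element under either convention. *)
Definition frobenius (S : set nat) : nat := \max_(x <- fset_set (gaps S)) x.

Definition left_elements (S : set nat) : set nat :=
  [set x | S x /\ x < frobenius S].

(* The gcd of the empty family is 0, so gcd_left S = 1 fails when S has no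
   nonzero left element. *)
Definition gcd_left (S : set nat) : nat :=
  \big[gcdn/0]_(x <- fset_set (left_elements S) | x != 0) x.

Definition semigroups_of_genus (g : nat) : set (set nat) :=
  [set S | numerical_semigroup S /\ genus S = g].

Definition semigroups_of_genus_gcd1 (g : nat) : set (set nat) :=
  [set S | semigroups_of_genus g S /\ gcd_left S = 1].

(* Cardinality of a finite set of sets of naturals; the value is 0 on an
   infinite family, but there are finitely many numerical semigroups of each
   genus g, since their gaps are all smaller than 2 * g. *)
Definition card_sets (A : set (set nat)) : nat := #|` fset_set A|.

(* Main.v *)
Require Import Defs.
From mathcomp Require Import all_boot all_order all_algebra finmap zify.
From mathcomp Require Import all_classical all_reals all_analysis.
Import Order.TTheory GRing.Theory Num.Theory.
Import numFieldNormedType.Exports.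
Local Open Scope classical_set_scope.
Local Open Scope ring_scope.

(** Let S have genus g, Frobenius number F and gcd of left elements different
    from 1. Then some d >= 2 divides all the left elements, so S is determined
    by F, d and the quotient T = {t | d t in S}. If t is a gap of T, both d t
    and d t - 1 are gaps of S, so T has genus at most g / 2; similarly F is at
    most 2 g + 1. Kunz coordinates form a composition of the genus, so there
    are at most 2^(g/2 + 1) choices for T, and the exceptional semigroups
    number O(g^2 2^(g/2)). On the other hand, the semigroups with F smaller
    than twice the multiplicity already give n_g >= C(2n, n) >= (2/3) 3^n for
    n = floor(g/3), and 3^(1/3) > 2^(1/2). *)

(** * Cardinality bounds from lists and parametrizations *)

Lemma uniq_size_fset_set (T : choiceType) (A : set T) (s : seq T) :
  finite_set A -> uniq s -> (forall x, x \in s -> A x) ->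
  (size s <= #|` fset_set A|)%N.
Proof.
move=> finA us sA; apply: uniq_leq_size => // x /sA Ax.
by rewrite in_fset_set// inE.
Qed.

(** Finiteness comes with the bound because [card_sets] is 0 on an infinite family, where the bound
    alone would be void. *)
Lemma card_sets_le_range (T : finType) (f : T -> set nat)
    (A : set (set nat)) :
  A `<=` range f -> finite_set A /\ (card_sets A <= #|T|)%N.
Proof.
move=> Af; have finA : finite_set A.
  by apply: sub_finite_set Af _; apply: finite_image; exact: finite_finset.
split=> //; rewrite /card_sets cardE -(size_map f).
apply: uniq_leq_size => // S; rewrite in_fset_set// inE => /Af[t _ <-].
by rewrite map_f// mem_enum.
Qed.

(** * Kunz coordinates and their encoding by sets of partial sums *)

Section Kunz.
Local Open Scope nat_scope.

(* [k] lists the Kunz coordinates of the residues 1, ..., m - 1 modulo the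
   multiplicity m. *)
Definition kunz_set (k : seq nat) : set nat :=
  [set x | nth 0 (0 :: k) (x %% (size k).+1) <= x %/ (size k).+1].

(** With [m] the multiplicity and [c i] the least [t] such that [i + t * m] is in [S], the gaps
    congruent to [i] are the [i + t * m] with [t < c i]. Minimality of [m] makes the coordinates
    positive. *)
Lemma kunz_coordinates (S : set nat) : numerical_semigroup S ->
  exists k, [/\ all (leq 1) k, sumn k <= genus S & S = kunz_set k].
Proof.
move=> [S0 SD finS].
have [N hN] : exists N, forall x, N < x -> S x.
  exists (\max_(x <- fset_set (~` S)) x) => x hx; apply: contrapT => nSx.
  have : x \in fset_set (~` S) by rewrite in_fset_set// inE.
  by move=> /(@leq_bigmax_seq _ _ predT id) /(_ isT); rewrite leqNgt hx.
have exm : exists m, (0 < m) && `[< S m >].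
  by exists N.+1; rewrite /=; apply/asboolP/hN.
case: (ex_minnP exm) => m /andP[m0 /asboolP Sm] minm.
have Sml t : S (t * m) by elim: t => // t IH; rewrite mulSn; apply: SD.
have ext i : exists t, `[< S (i + t * m) >].
  by exists N.+1; apply/asboolP/hN; nia.
pose c i := ex_minn (ext i).
have cP i t : S (i + t * m) <-> c i <= t.
  rewrite /c; case: ex_minnP => u /asboolP Su minu; split.
    by move=> Sit; apply: minu; apply/asboolP.
  move=> ut; rewrite -(subnK ut) mulnDl addnCA; apply: SD => //.
pose k := [seq c i | i <- iota 1 m.-1].
have sk : (size k).+1 = m by rewrite size_map size_iota prednK.
exists k; split.
- apply/allP => y /mapP[i]; rewrite mem_iota => /andP[i0 im] ->.
  rewrite lt0n; apply/negP => /eqP ci0.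
  have := (cP i 0).2; rewrite ci0 mul0n addn0 => /(_ isT) Si.
  by have := minm i; rewrite i0/= => /(_ (asboolT Si)); lia.
(* These gaps are pairwise distinct and number [sumn k]. *)
- have -> : sumn k = size [seq i + t * m | i <- iota 1 m.-1, t <- iota 0 (c i)].
    rewrite size_allpairs_dep; congr sumn; apply: eq_map => i.
    by rewrite size_iota.
  apply: uniq_size_fset_set => //.
    apply: allpairs_uniq_dep; [exact: iota_uniq|by move=> *; exact: iota_uniq|].
    move=> [i t] [j u] /allpairsPdep[i' [t' [hi ht [-> ->]]]].
    move=> /allpairsPdep[j' [u' [hj hu [-> ->]]]] /= E.
    move: hi hj; rewrite !mem_iota => hi hj.
    have E1 : i' = j'.
      have := congr1 (modn^~ m) E; rewrite !(addnC _ (_ * m)) !modnMDl !modn_small//; lia.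
    move: E; rewrite E1 => /addnI /eqP; rewrite eqn_pmul2r// => /eqP ->//.
  move=> x /allpairsPdep[i [t [_ ht ->]]] /cP.
  by move: ht; rewrite mem_iota; lia.
- apply/seteqP; rewrite /kunz_set sk; suff E x : S x <-> nth 0 (0 :: k) (x %% m) <= x %/ m.
    by split=> x /E.
  rewrite {1}(divn_eq x m) addnC cP.
  suff -> : nth 0 (0 :: k) (x %% m) = c (x %% m) by [].
  have := ltn_pmod x m0; case: (x %% m) => [|r] rm /=.
    by apply/esym/eqP; rewrite -leqn0; apply/cP.
  by rewrite (nth_map 0) ?size_iota ?nth_iota//; lia.
Qed.

Lemma scanl_addn_bounds (a : nat) (k : seq nat) : all (leq 1) k ->
  path ltn a (scanl addn a k) /\
  forall x, x \in scanl addn a k -> x <= a + sumn k.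
Proof.
elim: k a => //= y k IH a /andP[y0 /(IH (a + y))[-> H]]; split.
  by rewrite andbT; lia.
by move=> x; rewrite inE => /orP[/eqP->|/H]; lia.
Qed.

(* A set of partial sums in [0, N] determines the Kunz coordinates, hence the
   semigroup. *)
Definition semigroup_of_sums (N : nat) (A : {set 'I_N.+1}) : set nat :=
  kunz_set (pairmap (fun x y => y - x) 0
    [seq x <- iota 0 N.+1 | inord x \in A]).

Lemma semigroup_of_sums_surj (N : nat) (S : set nat) :
  numerical_semigroup S -> genus S <= N -> range (@semigroup_of_sums N) S.
Proof.
move=> /kunz_coordinates[k [k1 ks ES]] gN; rewrite [X in range _ X]ES.
have [sP sB] := @scanl_addn_bounds 0 _ k1.
exists [set i : 'I_N.+1 | (i : nat) \in scanl addn 0 k]%SET => //.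
rewrite /semigroup_of_sums; congr kunz_set.
(* Successive differences undo partial sums, so it remains to match the filtered range with the list
   of partial sums: both increase strictly and have the same members. *)
have addK x : cancel (addn x) (fun y => y - x) by move=> y; exact: addKn.
rewrite -[RHS](scanlK addK 0); congr pairmap; apply: (@irr_sorted_eq _ ltn).
- exact: ltn_trans.
- exact: ltnn.
- by apply: sorted_filter; [exact: ltn_trans|exact: iota_ltn_sorted].
- exact: path_sorted sP.
move=> x; rewrite mem_filter mem_iota add0n /=.
case: (ltnP x N.+1) => xN; first by rewrite inE inordK// andbT.
rewrite andbF; apply/esym/negP => /sB xk.
by move: xN; rewrite ltnNge (leq_trans xk (leq_trans ks gN)).
Qed.

Lemma finite_semigroups_of_genus (g : nat) :
  finite_set (semigroups_of_genus g).
Proof.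
apply: (@card_sets_le_range _ (@semigroup_of_sums g) _ _).1.
by move=> S [nS gS]; apply: semigroup_of_sums_surj; rewrite ?gS.
Qed.

End Kunz.

(** * Upper bound for the exceptional semigroups, lower bound for all *)

Section Counting.
Local Open Scope nat_scope.

Lemma gap_le_frobenius (S : set nat) (x : nat) :
  finite_set (~` S) -> ~ S x -> x <= frobenius S.
Proof.
move=> finS nSx; apply: (@leq_bigmax_seq _ _ predT id) => //.
by rewrite in_fset_set// inE.
Qed.

(** A maximum over a nonempty list is attained, so only the default value 0, when there is no gap,
    can lie in [S]. *)
Lemma frobenius_gap (S : set nat) :
  finite_set (~` S) -> S (frobenius S) -> frobenius S = 0.
Proof.
move=> finS; suff [|->//] : ~ S (frobenius S) \/ frobenius S = 0 by [].
rewrite /frobenius big_seq.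
apply: (big_ind (fun n => ~ S n \/ n = 0)); first by right.
- by move=> x y Hx Hy; case: (leqP x y).
- by move=> x; rewrite in_fset_set// inE; left.
Qed.

Lemma dvdn_gcd_left (S : set nat) (x : nat) :
  S x -> x < frobenius S -> gcd_left S %| x.
Proof.
move=> Sx xF; case: (posnP x) => [->//|x0].
have finL : finite_set (left_elements S).
  by apply: (@sub_finite_set _ _ `I_(frobenius S)) => // y [].
have xL : x \in fset_set (left_elements S) by rewrite in_fset_set// inE.
by rewrite /gcd_left (big_rem x xL)/= -lt0n x0 dvdn_gcdl.
Qed.

(** The upper bound on [d] leaves finitely many choices. If the gcd is 0 or exceeds the Frobenius
    number, the only possible left element is 0, and [d = 2] serves. *)
Lemma gcd_left_neq1 (S : set nat) : gcd_left S != 1 ->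
  exists d, [/\ 1 < d, d <= (frobenius S).+2 &
    forall x, S x -> x < frobenius S -> d %| x].
Proof.
move=> S1; have dvdS := @dvdn_gcd_left S.
have [gF|Fg] := leqP (gcd_left S) (frobenius S); last first.
  exists 2; split=> // x Sx xF; case: (posnP x) => [->//|x0].
  have := dvdn_leq x0 (dvdS x Sx xF); lia.
have [g0|g0] := posnP (gcd_left S); last first.
  by exists (gcd_left S); split=> //; lia.
exists 2; split=> // x Sx xF.
by have := dvdS x Sx xF; rewrite g0 dvd0n => /eqP ->.
Qed.

Section Quotient.
Variables (S : set nat) (d : nat).
Hypotheses (nS : numerical_semigroup S) (d1 : 1 < d)
  (dL : forall x, S x -> x < frobenius S -> d %| x).
Let T : set nat := [set t | S (d * t)].

Let finS : finite_set (~` S). Proof. by case: nS. Qed.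

Let muldI : injective (muln d).
Proof. by move=> x y /eqP; rewrite eqn_pmul2l ?(ltnW d1)// => /eqP. Qed.

Lemma numerical_semigroup_quotient : numerical_semigroup T.
Proof.
case: nS => S0 SD _; split; first by rewrite /T/= muln0.
  by move=> x y Tx Ty; rewrite /T/= mulnDr; apply: SD.
by apply: (@finite_preimage _ _ (~` S) (muln d)) => // x y _ _ /muldI.
Qed.

Let ndvd t : 0 < t -> ~~ (d %| (d * t).-1).
Proof.
move=> t0; apply/negP => dt; have : d %| (d * t).-1 + 1.
  by rewrite addn1 prednK ?dvdn_mulr// muln_gt0 t0 ltnW.
by rewrite dvdn_addr// dvdn1; lia.
Qed.

(* Each gap t of the quotient yields two gaps d t and d t - 1 of S. *)
Lemma genus_quotient : (genus T).*2 <= genus S.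
Proof.
case: numerical_semigroup_quotient => T0 _ finT.
set s : seq nat := fset_set (~` T).
have sT t : t \in s -> ~ S (d * t) /\ 0 < t.
  rewrite /s in_fset_set// inE /= => nTt; split => //.
  by case: t nTt => // /(_ T0).
have -> : (genus T).*2 =
    size ([seq d * t | t <- s] ++ [seq (d * t).-1 | t <- s]).
  by rewrite size_cat !size_map addnn.
apply: uniq_size_fset_set => //.
  rewrite cat_uniq (map_inj_uniq muldI) map_inj_in_uniq ?fset_uniq /=; last first.
    by move=> t u /sT[_ t0] /sT[_ u0] E; apply: muldI; nia.
  rewrite andbT; apply/hasPn => x /mapP[t /sT[_ t0] ->].
  by apply/negP => /mapP[u _ E]; have := ndvd _ t0; rewrite E dvdn_mulr.
move=> x; rewrite mem_cat => /orP[] /mapP[t /sT[nt t0] ->] //.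
(* As [d * t] is a gap, [d * t - 1] is below the Frobenius number; in [S] it would be a left
   element, hence divisible by [d]. *)
move=> /dL dS; have tF := gap_le_frobenius _ _ finS nt.
have dt0 : 0 < d * t by rewrite muln_gt0 t0 ltnW.
by have := ndvd _ t0; rewrite dS// (leq_trans _ tF)// prednK.
Qed.

(** Of two consecutive integers [2 j] and [2 j + 1] below the Frobenius number, one is not divisible
    by [d], hence is a gap. *)
Lemma frobenius_le_genus : frobenius S <= (genus S).*2.+1.
Proof.
suff : (frobenius S)./2 <= genus S by lia.
rewrite -{1}(size_iota 0 (frobenius S)./2).
rewrite -(size_map (fun j => if d %| j.*2 then j.*2.+1 else j.*2)).
apply: uniq_size_fset_set => //.
  rewrite map_inj_uniq ?iota_uniq// => i j; case: ifP; case: ifP; lia.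
move=> x /mapP[j]; rewrite mem_iota => jF -> /dL.
case: ifPn => dj dS; last by move: dj; rewrite dS//; lia.
have : d %| j.*2 + 1 by rewrite addn1 dS//; lia.
by rewrite dvdn_addr// dvdn1; lia.
Qed.

Lemma quotient_eq :
  S = [set x | frobenius S < x \/ (d %| x /\ T (x %/ d))].
Proof.
apply/seteqP; split=> x /=.
  move=> Sx; have [xF|Fx|xF] := ltngtP x (frobenius S); [|by left|].
    have dx := dL _ Sx xF; right; split=> //.
    by rewrite /T/= mulnC divnK.
  (* The Frobenius number lies in [S] only if it is 0, and 0 falls under the second alternative. *)
  rewrite xF in Sx *; rewrite (frobenius_gap _ finS Sx); right.
  by rewrite dvdn0 div0n /T/= muln0; case: nS.
move=> [Fx|[dx]]; last by rewrite /T/= mulnC divnK.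
by apply: contrapT => /(gap_le_frobenius _ _ finS); rewrite leqNgt Fx.
Qed.

End Quotient.

Lemma card_gcd_neq1 (g : nat) :
  card_sets (semigroups_of_genus g `\` semigroups_of_genus_gcd1 g)
    <= g.*2.+4 ^ 2 * 2 ^ g./2.+1.
Proof.
(* The triple holds the Frobenius number, at most [2 g + 1], the divisor, at most [2 g + 3], and the
   partial sums encoding the quotient. *)
pose f (p : 'I_g.*2.+4 * 'I_g.*2.+4 * {set 'I_g./2.+1}) : set nat :=
  [set x | p.1.1 < x \/
    (p.1.2 %| x /\ semigroup_of_sums g./2 p.2 (x %/ p.1.2))].
have -> : g.*2.+4 ^ 2 * 2 ^ g./2.+1 =
    #|{: 'I_g.*2.+4 * 'I_g.*2.+4 * {set 'I_g./2.+1}}|.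
  by rewrite !card_prod !card_ord -cardsT -powersetT card_powerset cardsT card_ord.
apply: (@card_sets_le_range _ f _ _).2 => S [[nS gS] S1].
have /gcd_left_neq1[d [d1 dF dL]] : gcd_left S != 1.
  by apply/eqP => S1'; apply: S1.
have Fg := frobenius_le_genus _ _ nS d1 dL; rewrite gS in Fg.
have [|A _ EA] := @semigroup_of_sums_surj g./2 _ (numerical_semigroup_quotient _ _ nS d1).
  by have := genus_quotient _ _ nS d1 dL; lia.
exists (inord (frobenius S), inord d, A) => //.
by rewrite [RHS](quotient_eq _ _ nS dL) /f/= !inordK ?EA//; lia.
Qed.

(* The gaps are 1, ..., a together with b elements strictly between the
   multiplicity a + 1 and its double. *)
Lemma bin_le_card_semigroups (a b : nat) :
  'C(a, b) <= card_sets (semigroups_of_genus (a + b)).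
Proof.
pose f (B : {set 'I_a}) : set nat := [set x | x = 0 \/
  a < x /\ forall i, i \in B -> x != (a + 2 + i)%N].
rewrite -{1}(card_ord a) -card_draws cardE -(size_map f).
apply: uniq_size_fset_set.
- exact: finite_semigroups_of_genus.
- rewrite map_inj_uniq ?enum_uniq// => B C E; apply/setP => i.
  suff fP (D : {set 'I_a}) : i \in D <-> ~ f D (a + 2 + i).
    by apply/idP/idP => /fP; [rewrite E|rewrite -E] => /fP.
  split=> [iD [|[_ /(_ _ iD)]]|nf]; [lia|by rewrite eqxx|].
  apply: contrapT => /negP iD; apply: nf; right; split=> [|j jD]; first lia.
  by rewrite eqn_add2l; apply: contra iD => /eqP /ord_inj ->.
move=> S /mapP[B]; rewrite mem_enum inE => /eqP cB ->.
pose s := iota 1 a ++ [seq (a + 2 + (i : 'I_a))%N | i <- enum B].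
have sP x : ~ f B x <-> x \in s.
  rewrite mem_cat mem_iota; split.
    move=> nf; case: (leqP x a) => xa.
      by apply/orP; left; case: x nf xa => [|x]; [case; left|lia].
    apply/orP; right; apply: contrapT => xB; apply: nf; right; split=> // i iB.
    by apply/eqP => xE; apply: xB; apply/mapP; exists i; rewrite ?mem_enum.
  move=> /orP[xa [|[]]|/mapP[i]]; [lia|lia|rewrite mem_enum => iB -> [|[_]]].
    by lia.
  by move=> /(_ _ iB); rewrite eqxx.
have gE : ~` f B = [set` s] by apply/seteqP; split=> x /sP.
split; first split.
- by left.
- move=> x y [->|[xa Hx]]; first by rewrite add0n.
  (* Two nonzero elements add up to at least [2 a + 2], beyond all the excluded values. *)
  move=> [->|[ya Hy]]; first by rewrite addn0; right.
  right; split=> [|i _]; [lia|apply/eqP; have := ltn_ord i; lia].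
- by rewrite gE; exact: finite_seq.
rewrite /genus /gaps gE.
have us : uniq s.
  rewrite cat_uniq iota_uniq map_inj_uniq ?enum_uniq ?andbT /=; last first.
    by move=> i j /addnI /ord_inj.
  by apply/hasPn => _ /mapP[i _ ->]; rewrite mem_iota; lia.
have : perm_eq (fset_set [set` s]) s.
  apply: uniq_perm => // x; rewrite in_fset_set; last exact: finite_seq.
  by apply/idP/idP; rewrite inE.
by move=> /perm_size ->; rewrite size_cat size_iota size_map -cardE cB.
Qed.

(** From [n] to [n + 1] the central binomial coefficient grows by the factor
    [2 (2 n + 1) / (n + 1)], which is at least 3 once [n >= 1]; equality at [n = 1] explains the
    constants. *)
Lemma central_bin_ge (n : nat) : 2 * 3 ^ n <= 3 * 'C(n.*2, n).
Proof.
case: n => // n; elim: n => // n IH.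
have E1 := mul_bin_diag n.+2.*2 n.+1.
have E2 := mul_bin_down n.+1.*2.+1 n.+1.
rewrite /= in E1 E2; rewrite expnS; move: IH E1 E2; rewrite !doubleS /=.
set p := 3 ^ _; set c := 'C(_, _) => IH; set e := 'C(_, _); set h := 'C(_, _).
move=> E1 E2; have : 3 * c <= h by nia.
nia.
Qed.
End Counting.

Section Asymptotics.
Local Open Scope nat_scope.

Lemma leq_exp_ffact (n j : nat) : (n - j) ^ j.+1 <= n ^_ j.+1.
Proof.
elim: j n => [|j IH] [|n] //; first by rewrite subn0 ffactn1.
by rewrite ffactSS expnS leq_mul ?leq_subr ?subSS.
Qed.

Lemma leq_bin_expS (a n k : nat) : k <= n -> 'C(n, k) * a ^ (n - k) <= a.+1 ^ n.
Proof.
move=> kn; rewrite -addn1 expnDn.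
have kn1 : k < n.+1 by [].
by rewrite (bigD1 (Ordinal kn1))//= exp1n muln1 leq_addr.
Qed.

(** The binomial expansion of [a.+1 ^ n] contains the term ['C(n, j.+1) * a ^ (n - j.+1)], whose
    polynomial factor has degree [j + 1]. [D] clears denominators, and [M] absorbs the constants
    together with [n <= 2 (n - j)]. *)
Lemma exp_dominates (K j a : nat) : 0 < a ->
  exists n0, forall n, n0 <= n -> K * n ^ j * a ^ n <= a.+1 ^ n.
Proof.
move=> a0; pose D := a ^ j.+1 * j.+1`!; pose M := K * 2 ^ j * D.
exists (M + j.*2.+1) => n hn.
have D0 : 0 < D by rewrite muln_gt0 expn_gt0 a0 fact_gt0.
have jn : j.+1 <= n by lia.
rewrite -(leq_pmul2r D0).
apply: (@leq_trans ((n - j) ^ j.+1 * a ^ n)); last first.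
  have := leq_bin_expS a _ _ jn; rewrite -(leq_pmul2r D0); apply: leq_trans.
  rewrite /D [a ^ _ * _`!]mulnC mulnACA bin_ffact leq_mul ?leq_exp_ffact//.
  by rewrite -expnD subnK.
rewrite mulnAC leq_pmul2r ?expn_gt0 ?a0// expnS.
apply: (@leq_trans (M * (n - j) ^ j)); last by rewrite leq_mul//; lia.
rewrite /M mulnAC [K * _ * D]mulnAC -[leqRHS]mulnA leq_mul//.
rewrite -expnMn; case: (posnP j) => [->//|j0]; rewrite leq_exp2r//; lia.
Qed.

Lemma gcd_neq1_negligible (K : nat) : exists g0, forall g, g0 <= g ->
  K * card_sets (semigroups_of_genus g `\` semigroups_of_genus_gcd1 g)
    <= card_sets (semigroups_of_genus g).
Proof.
(* The final comparison is between squares, [9 ^ n] against [2 ^ g <= 4 * 8 ^ n]; squaring the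
   quadratic factor gives degree 4, and 14 comes from [2 g + 4 <= 6 n + 8 <= 14 n]. *)
have [n0 hn0] := exp_dominates ((3 * K * 14 ^ 2) ^ 2 * 4) 4 8 isT.
exists (3 * n0 + 3) => g hg; pose n := g %/ 3.
have n1 : 0 < n by rewrite /n; lia.
have /hn0 : n0 <= n by rewrite /n; lia.
have gn : g < 3 * n + 3 by rewrite /n; lia.
have := bin_le_card_semigroups (g - n) n.
rewrite subnK; last by rewrite /n; lia.
move=> low big; apply: leq_trans low.
apply: (@leq_trans 'C(n.*2, n)); last by apply: leq_bin2l; rewrite /n; lia.
rewrite -(@leq_pmul2l 3)//; apply: leq_trans (central_bin_ge n).
apply: (@leq_trans (3 * (K * (g.*2.+4 ^ 2 * 2 ^ g./2.+1)))).
  by rewrite !leq_mul// card_gcd_neq1.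
set h := g./2; have -> : 3 * (K * (g.*2.+4 ^ 2 * 2 ^ h.+1)) =
    2 * (3 * K * g.*2.+4 ^ 2 * 2 ^ h) by rewrite (expnS 2 h); lia.
rewrite leq_pmul2l// -(@leq_exp2r _ _ 2)// -[leqRHS]expnM (mulnC n) expnM.
apply: leq_trans big.
apply: (@leq_trans ((3 * K * 14 ^ 2 * n ^ 2 * 2 ^ h) ^ 2)).
  rewrite leq_exp2r// leq_mul2r -(mulnA (3 * K)) -expnMn leq_mul2l leq_exp2r//.
  by apply/orP; right; apply/orP; right; lia.
move: (3 * K * 14 ^ 2) => c.
have -> : (c * n ^ 2 * 2 ^ h) ^ 2 = c ^ 2 * n ^ 4 * 2 ^ (h * 2).
  by rewrite !expnMn -!expnM -expnD.
have -> : c ^ 2 * 4 * n ^ 4 * 8 ^ n = c ^ 2 * n ^ 4 * 2 ^ (2 + 3 * n).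
  by rewrite expnD expnM mulnA (mulnAC (c ^ 2) 4).
by rewrite leq_mul// leq_exp2l// /h; lia.
Qed.
End Asymptotics.

Theorem theorem1 (R : realType) :
  (fun g : nat => (card_sets (semigroups_of_genus_gcd1 g))%:R
                  / (card_sets (semigroups_of_genus g))%:R : R) @ \oo --> (1 : R).
Proof.
apply/cvgrPdist_le => e e0.
(* This factor exceeds [1 / e], so the exceptional proportion is eventually at most [e]. *)
have [g0 hg0] := gcd_neq1_negligible (Num.truncn e^-1).+1.
near=> g.
have {hg0} /hg0 H : (g0 <= g)%N by near: g; exact: nbhs_infty_ge.
have finS := finite_semigroups_of_genus g.
have sub : semigroups_of_genus_gcd1 g `<=` semigroups_of_genus g by move=> S [].
have n0 : (0 < card_sets (semigroups_of_genus g))%N.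
  (* The case [b = 0] gives at least one semigroup of each genus, so the denominator is nonzero. *)
  have := bin_le_card_semigroups g 0; rewrite bin0 addn0//.
have E : card_sets (semigroups_of_genus g) =
    (card_sets (semigroups_of_genus_gcd1 g) +
     card_sets (semigroups_of_genus g `\` semigroups_of_genus_gcd1 g))%N.
  have finG := sub_finite_set sub finS.
  rewrite /card_sets fset_setD// -(cardfsID (fset_set (semigroups_of_genus_gcd1 g))).
  by rewrite -fset_setI// (setIidr sub).
move: H n0; rewrite -(ler_nat R) -(ltr0n R) natrM.
have := congr1 (fun k => k%:R : R) E; rewrite natrD.
set n : R := (card_sets (semigroups_of_genus g))%:R.
set b : R := _%:R; set a : R := _%:R.
move=> nE H n0.
have -> : 1 - b / n = a / n.
  by rewrite -[X in X - _](divff (lt0r_neq0 n0)) -mulrBl {1}nE addrAC subrr add0r.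
rewrite ger0_norm ?divr_ge0 ?(ltW n0)// ler_pdivrMr//.
rewrite -ler_pdivrMl//; apply: le_trans H.
by rewrite ler_wpM2r// ltW// truncnS_gt.
Unshelve. all: by end_near.
Qed.
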